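(* Let $[X,d,m]$ be a metric random walk space with invariant and reversible probability measure $\nu$, and assume $\Delta_m$ is ergodic. Then: (1) for $K>0$ and $n\in(1,\infty)$, $\Delta_m$ satisfies the integrated Bakry-Émery condition $IBE(K,n)$ if and only if a Poincaré inequality with constant $K\frac{n}{n-1}$ holds; (2) for $K>0$, $\Delta_m$ satisfies $IBE(K,\infty)$ if and only if a Poincaré inequality with constant $K$ holds. Consequently, if $\Delta_m$ satisfies the Bakry-Émery condition $BE(K,n)$ with $K>0$, then ${\rm gap}(-\Delta_m)\ge K\frac n{n-1}$; and if $\Delta_m$ satisfies $BE(K,\infty)$ with $K>0$, then ${\rm gap}(-\Delta_m)\ge K$.
   Context: A metric random walk space $[X,d,m]$ is a Polish metric space $(X,d)$ with a family $m=(m_x)_{x\in X}$ of Borel probability measures, $x\mapsto m_x(A)$ Borel measurable, each with finite first moment. A Radon measure $\nu$ is invariant if $\nu(A)=\int_X m_x(A)d\nu(x)$ for all $\nu$-measurable $A$, reversible if $dm_x(y)d\nu(x)=dm_y(x)d\nu(y)$. $\Delta_m f(x)=\int_X(f(y)-f(x))dm_x(y)$; $\Delta_m$ is ergodic if $\Delta_m u=0$ implies $u$ is $\nu$-a.e. constant. $\mathcal H_m(f)=\frac12\iint(f(y)-f(x))^2dm_x(y)d\nu(x)$, ${\rm Var}_\nu(f)=\int_X(f-\int fd\nu)^2d\nu$, ${\rm gap}(-\Delta_m)=\inf\{\mathcal H_m(f)/{\rm Var}_\nu(f):{\rm Var}_\nu(f)\ne0\}$. A Poincaré inequality with constant $\lambda$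 means $\lambda{\rm Var}_\nu(f)\le\mathcal H_m(f)$ for all $f\in L^2(X,\nu)$. Carré du champ: $\Gamma(f,g)=\frac12(\Delta_m(fg)-f\Delta_m g-g\Delta_m f)$, $\Gamma(f)=\Gamma(f,f)$, $\Gamma_2(f)=\frac12\Delta_m\Gamma(f)-\Gamma(f,\Delta_m f)$. $BE(K,n)$: $\Gamma_2(f)\ge\frac1n(\Delta_m f)^2+K\Gamma(f)$ for all $f\in L^2(X,\nu)$; $BE(K,\infty)$: $\Gamma_2(f)\ge K\Gamma(f)$ for all $f\in L^2(X,\nu)$. $IBE(K,n)$: $K\frac n{n-1}\mathcal H_m(f)\le\int_X(\Delta_m f)^2d\nu$ for all $f\in L^2(X,\nu)$; $IBE(K,\infty)$: $K\mathcal H_m(f)\le\int_X(\Delta_m f)^2d\nu$ for all $f\in L^2(X,\nu)$. *)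

(* Defs.v *)
From HB Require Import structures.
From mathcomp Require Import all_boot all_order all_algebra.
From mathcomp Require Import all_classical all_reals all_analysis.
Set Implicit Arguments. Unset Strict Implicit. Unset Printing Implicit Defensive.
Import Order.TTheory GRing.Theory Num.Theory.
Local Open Scope classical_set_scope.
Local Open Scope ring_scope.

Section MRWS.
Context {R : realType} {d : measure_display} {T : measurableType d}.

Definition is_metric (dist : T -> T -> R) : Prop :=
  (forall x y, 0 <= dist x y) /\
  (forall x y, dist x y = 0 <-> x = y) /\
  (forall x y, dist x y = dist y x) /\
  (forall x y z, dist x z <= dist x y + dist y z).

Definition dist_open (dist : T -> T -> R) (U : set T) : Prop :=
  forall x, U x -> exists2 e : R, 0 < e & [set y | dist x y < e] `<=` U.

Definition polish_borel (dist : T -> T -> R) : Prop :=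
  is_metric dist /\
  (forall u : nat -> T,
     (forall e : R, 0 < e -> exists N, forall p q, (N <= p)%N -> (N <= q)%N ->
        dist (u p) (u q) < e) ->
     exists l, forall e : R, 0 < e -> exists N, forall p, (N <= p)%N -> dist (u p) l < e) /\
  (exists D : set T, countable D /\
     forall x (e : R), 0 < e -> exists2 y, D y & dist x y < e) /\
  (@measurable d T = <<s dist_open dist >>).

Definition metric_random_walk (dist : T -> T -> R) (m : R.-pker T ~> T) : Prop :=
  polish_borel dist /\
  forall x, (m x).-integrable setT (fun y => (dist x y)%:E).

Definition nu_invariant (m : R.-pker T ~> T) (nu : probability T R) : Prop :=
  forall A, measurable A -> nu A = (\int[nu]_x m x A)%E.

(** dm_x(y) dnu(x) = dm_y(x) dnu(y), tested on measurable rectangles *)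
Definition nu_reversible (m : R.-pker T ~> T) (nu : probability T R) : Prop :=
  forall A B, measurable A -> measurable B ->
    (\int[nu]_(x in A) m x B = \int[nu]_(x in B) m x A)%E.

Definition Lap (m : R.-pker T ~> T) (f : T -> R) (x : T) : R :=
  fine (\int[m x]_y ((f y - f x)%:E)).

Definition L2 (nu : probability T R) (f : T -> R) : Prop :=
  measurable_fun setT f /\ nu.-integrable setT (fun x => (f x ^+ 2)%:E).

Definition Hm (m : R.-pker T ~> T) (nu : probability T R) (f : T -> R) : \bar R :=
  ((2^-1)%:E * \int[nu]_x \int[m x]_y (((f y - f x) ^+ 2)%:E))%E.

Definition Var (nu : probability T R) (f : T -> R) : \bar R :=
  (\int[nu]_x (((f x - fine (\int[nu]_y (f y)%:E)) ^+ 2)%:E))%E.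

Definition gap (m : R.-pker T ~> T) (nu : probability T R) : \bar R :=
  ereal_inf [set (fine (Hm m nu f) / fine (Var nu f))%:E
            | f in [set f | L2 nu f /\ Var nu f != 0%E]].

Definition Lap_ergodic (m : R.-pker T ~> T) (nu : probability T R) : Prop :=
  forall u, L2 nu u -> {ae nu, forall x, Lap m u x = 0} ->
    exists c : R, {ae nu, forall x, u x = c}.

Definition poincare (m : R.-pker T ~> T) (nu : probability T R) (lam : R) : Prop :=
  forall f, L2 nu f -> (lam%:E * Var nu f <= Hm m nu f)%E.

Definition Gamma (m : R.-pker T ~> T) (f g : T -> R) (x : T) : R :=
  (Lap m (f \* g) x - f x * Lap m g x - g x * Lap m f x) / 2.

Definition Gamma2 (m : R.-pker T ~> T) (f : T -> R) (x : T) : R :=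
  Lap m (Gamma m f f) x / 2 - Gamma m f (Lap m f) x.

Definition BE (m : R.-pker T ~> T) (nu : probability T R) (K n : R) : Prop :=
  forall f, L2 nu f ->
    {ae nu, forall x, (Lap m f x) ^+ 2 / n + K * Gamma m f f x <= Gamma2 m f x}.

Definition BE_inf (m : R.-pker T ~> T) (nu : probability T R) (K : R) : Prop :=
  forall f, L2 nu f -> {ae nu, forall x, K * Gamma m f f x <= Gamma2 m f x}.

Definition IBE (m : R.-pker T ~> T) (nu : probability T R) (K n : R) : Prop :=
  forall f, L2 nu f ->
    ((K * (n / (n - 1)))%:E * Hm m nu f <= \int[nu]_x ((Lap m f x) ^+ 2)%:E)%E.

Definition IBE_inf (m : R.-pker T ~> T) (nu : probability T R) (K : R) : Prop :=
  forall f, L2 nu f -> (K%:E * Hm m nu f <= \int[nu]_x ((Lap m f x) ^+ 2)%:E)%E.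

End MRWS.

(* Main.v *)
(* Put J(dx, dy) = m_x(dy) nu(dx), a probability on T * T that reversibility
   makes symmetric, Df(x, y) = f y - f x, and E(f, g) = 1/2 int Df Dg dJ.
   Symmetry of J yields Green's formula <f, Lap g> = - E(f, g) in L^2(nu), and
   Jensen's inequality gives |Lap f|^2 <= 2 E(f, f).

   Poincare implies the integrated condition lam E(f, f) <= |Lap f|^2 by
   Cauchy-Schwarz applied to E(f, f) = - <f - mean f, Lap f>.  Integrating BE
   gives IBE, because int Lap h = 0 for h in L^1 and hence
   int Gamma_2(f) = |Lap f|^2.

   The converse replaces the spectral theorem by a relaxation.  Cauchy-Schwarz
   for E turns the integrated condition into lam |v|^2 <= E(v, v) for v in the
   range of Lap, so that Q = 1 + Lap / 2 contracts this range.  For h of mean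
   zero the increments of Q^k h lie in it, hence Q^k h converges geometrically
   in L^2 to some g with Lap g = 0, and g = 0 by ergodicity.  Finally
   s = h - Q^k h equals - Lap G / 2 for G = sum_(j < k) Q^j h, whence
   lam <h, s>^2 <= E(h, h) |s|^2; let k tend to infinity. *)
Require Import Defs.
From HB Require Import structures.
From mathcomp Require Import all_boot all_order all_algebra.
From mathcomp Require Import all_classical all_reals all_analysis.
From mathcomp Require Import measurable_realfun.
From mathcomp Require Import ring lra.
Set Implicit Arguments. Unset Strict Implicit. Unset Printing Implicit Defensive.
Import Order.TTheory GRing.Theory Num.Theory.
Import numFieldNormedType.Exports.
Local Open Scope classical_set_scope.
Local Open Scope ring_scope.

(** * The joint law of a measure and a kernel *)

Section joint_measure.
Context {R : realType} {d1 d2 : measure_display}.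
Context {X : measurableType d1} {Y : measurableType d2}.
Variables (nu : probability X R) (m : R.-pker X ~> Y).
Local Open Scope ereal_scope.

Let measurable_pairl (x : X) : measurable_fun [set: Y] (pair x).
Proof. exact: measurable_pair1. Qed.

(* The dummy parameter in [unit] makes [joint] an instance of [kcomp], from
   which it inherits the Tonelli formula [integral_kcomp]. *)
Definition graph_kernel (ux : unit * X) : {measure set (X * Y) -> \bar R}.
Proof.
refine (pushforward (m ux.2) (pair ux.2) : {measure set (X * Y) -> \bar R}).
exact: measurable_pairl.
Defined.

Let measurable_graph_kernel A : measurable A ->
  measurable_fun [set: unit * X] (graph_kernel ^~ A).
Proof.
move=> mA.
rewrite [X in measurable_fun _ X](_ : _ = (fun x => m x (xsection A x)) \o snd).
  apply: measurableT_comp => //.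
  by apply: measurable_fun_xsection_finite_kernel; rewrite inE.
by apply/funext => x; rewrite /= xsectionE.
Qed.

HB.instance Definition _ :=
  isKernel.Build _ _ _ _ _ graph_kernel measurable_graph_kernel.

Let graph_kernel_prob ux : graph_kernel ux [set: X * Y] = 1.
Proof. by rewrite /graph_kernel /= /pushforward preimage_setT prob_kernel. Qed.

HB.instance Definition _ :=
  Kernel_isProbability.Build _ _ _ _ _ graph_kernel graph_kernel_prob.

Definition const_kernel : R.-pker unit ~> X :=
  kprobability (measurable_cst (nu : pprobability X R)).

Definition joint : set (X * Y) -> \bar R := kcomp const_kernel graph_kernel tt.

HB.instance Definition _ := Measure.copy joint (mkcomp const_kernel graph_kernel tt).

Lemma ge0_integral_joint (f : X * Y -> \bar R) :
  (forall z, 0 <= f z) -> measurable_fun [set: X * Y] f ->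
  \int[joint]_z f z = \int[nu]_x \int[m x]_y f (x, y).
Proof.
move=> f0 mf; rewrite /= integral_kcomp//; apply: eq_integral => x _.
by rewrite ge0_integral_pushforward.
Qed.

Lemma joint_setX (A : set X) (B : set Y) : measurable A -> measurable B ->
  joint (A `*` B) = \int[nu]_(x in A) m x B.
Proof.
move=> mA mB; rewrite /joint /= /kcomp [RHS]integral_mkcond.
apply: eq_integral => x _; rewrite patchE /graph_kernel /= /pushforward.
case: ifPn => [/set_mem Ax|/negP Ax].
  suff -> : pair x @^-1` (A `*` B) = B by [].
  by apply/seteqP; split => y //= [].
suff -> : pair x @^-1` (A `*` B) = set0 by rewrite measure0.
by apply/seteqP; split => y //= [] /mem_set.
Qed.

Let jointT : joint setT = 1.
Proof.
rewrite -setXTT joint_setX//; under eq_integral do rewrite prob_kernel.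
rewrite integral_cst// mul1e. exact: probability_setT.
Qed.

HB.instance Definition _ := Measure_isProbability.Build _ _ _ joint jointT.

Section section_integral.
Variable k : X * Y -> R.
Hypothesis ik : joint.-integrable setT (EFin \o k).

Let mk : measurable_fun setT k.
Proof. by apply/measurable_EFinP; exact: measurable_int ik. Qed.

Let mkx x : measurable_fun setT (fun y => k (x, y)).
Proof. by apply: measurableT_comp => //; exact: measurable_pair1. Qed.

Let integrable_normr_section :
  nu.-integrable setT (fun x => \int[m x]_y (`|(k (x, y))%:E|)).
Proof.
have mabs : measurable_fun setT (abse \o (EFin \o k)).
  by apply: measurableT_comp => //; exact/measurable_EFinP.
apply/integrableP; split.
  by apply: (measurable_fun_integral_finite_kernel (abse \o (EFin \o k)) m) => //=.
under eq_integral do rewrite gee0_abs ?integral_ge0//.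
case/integrableP : ik => _.
by rewrite (@ge0_integral_joint (abse \o (EFin \o k)))//= => z; exact: abse_ge0.
Qed.

(** The iterated integral of [|k|] is finite, so its inner integral is finite for almost every
    [x]. *)
Lemma ae_integrable_section :
  {ae nu, forall x, (m x).-integrable setT (fun y => (k (x, y))%:E)}.
Proof.
apply: filterS (integrable_ae measurableT integrable_normr_section) => x /(_ I) kx.
apply/integrableP; split; first exact/measurable_EFinP.
by rewrite -ge0_fin_numE// integral_ge0.
Qed.

Let measurable_pos : measurable_fun setT
  (fun x => \int[m x]_y ((EFin \o k)^\+ (x, y))).
Proof.
apply: measurable_fun_integral_finite_kernel => //.
by apply: measurable_funepos; exact/measurable_EFinP.
Qed.

Let measurable_neg : measurable_fun setT
  (fun x => \int[m x]_y ((EFin \o k)^\- (x, y))).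
Proof.
apply: measurable_fun_integral_finite_kernel => //.
by apply: measurable_funeneg; exact/measurable_EFinP.
Qed.

Let integral_sectionE x : \int[m x]_y (k (x, y))%:E =
  \int[m x]_y ((EFin \o k)^\+ (x, y)) - \int[m x]_y ((EFin \o k)^\- (x, y)).
Proof.
by rewrite [LHS]integralE; congr (_ - _); apply: eq_integral => y _;
  rewrite ?funeposE ?funenegE.
Qed.

(** Holds on all of [X], also where the section is not integrable: the inner integral is everywhere
    a difference of two measurable extended-real functions, and [fine] is measurable. *)
Lemma measurable_section_integral :
  measurable_fun setT (fun x => (\int[m x]_y k (x, y))%R).
Proof.
apply: measurableT_comp => //.
rewrite (_ : (fun x => _) = (fun x => \int[m x]_y ((EFin \o k)^\+ (x, y)) -
    \int[m x]_y ((EFin \o k)^\- (x, y)))).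
  exact: emeasurable_funB.
by apply/funext => x; exact: integral_sectionE.
Qed.

Lemma integrable_section_integral :
  nu.-integrable setT (fun x => (\int[m x]_y k (x, y))%:E).
Proof.
apply: le_integrable integrable_normr_section => //.
  exact/measurable_EFinP/measurable_section_integral.
move=> x _; rewrite [leRHS]gee0_abs ?integral_ge0//.
apply: le_trans (le_abse_integral _ _ _) => //; last exact/measurable_EFinP.
(* Where the inner integral is infinite, [fine] returns 0 and the bound is trivial. *)
by rewrite /Rintegral; case: (integral _ _ _) => [r| |]//=; rewrite normr0 leey.
Qed.

(** Fubini, by Tonelli on the positive and negative parts of [k]. Because of [fine], the inner
    integral is the difference of the two parts only where the section is integrable, that is almost
    everywhere. *)
Lemma Rintegral_joint :
  (\int[nu]_x \int[m x]_y k (x, y))%R = (\int[joint]_z k z)%R.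
Proof.
have ikp := integrable_funepos measurableT ik.
have ikn := integrable_funeneg measurableT ik.
have mkp := measurable_int _ ikp; have mkn := measurable_int _ ikn.
have fin_section f : joint.-integrable setT f -> (forall z, 0 <= f z) ->
    measurable_fun setT (fun x => \int[m x]_y f (x, y)) ->
    nu.-integrable setT (fun x => \int[m x]_y f (x, y)).
  move=> fi f0 mf; apply/integrableP; split => //.
  under eq_integral do rewrite gee0_abs ?integral_ge0//.
  rewrite -ge0_integral_joint//; last exact: measurable_int fi.
  case/integrableP: fi => _; under eq_integral do rewrite gee0_abs//.
  by [].
have ipos := fin_section _ ikp (fun z => funepos_ge0 _ z) measurable_pos.
have ineg := fin_section _ ikn (fun z => funeneg_ge0 _ z) measurable_neg.
congr fine; rewrite [RHS]integralE !ge0_integral_joint// -integralB//.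
apply: ae_eq_integral => //.
- exact/measurable_EFinP/measurable_section_integral.
- exact: emeasurable_funB.
apply: filterS ae_integrable_section => x kx _ /=.
by rewrite -integral_sectionE fineK// integrable_fin_num.
Qed.

End section_integral.

End joint_measure.

(** * The space L^2 of a probability measure *)

Lemma discriminant_le (R : realFieldType) (a b c : R) : 0 <= c ->
  (forall t, 0 <= a + 2 * t * b + t ^+ 2 * c) -> b ^+ 2 <= a * c.
Proof.
rewrite le_eqVlt => /predU1P[<-|c0] H.
- rewrite mulr0; have [->|b0] := eqVneq b 0; first by rewrite expr0n.
  (* With [c] zero the form is affine in [t], and this value of [t] would make it -1. *)
  have := H (- (a + 1) / (2 * b)).
  have -> : a + 2 * (- (a + 1) / (2 * b)) * b + (- (a + 1) / (2 * b)) ^+ 2 * 0 = -1.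
    by field.
  by lra.
(* The minimiser of the quadratic. *)
- have := H (- b / c).
  have -> : a + 2 * (- b / c) * b + (- b / c) ^+ 2 * c = (a * c - b ^+ 2) / c.
    by field; rewrite gt_eqF.
  by rewrite pmulr_lge0 ?invr_gt0// subr_ge0.
Qed.

Section L2_space.
Context {R : realType} {d : measure_display} {T : measurableType d}.
Variable mu : probability T R.
Implicit Types f g h : T -> R.

Definition dotp f g : R := \int[mu]_x (f x * g x).

Lemma Rintegral_prob_cst (c : R) : \int[mu]_x c = c.
Proof. by rewrite Rintegral_cst// [X in fine X]probability_setT mulr1. Qed.

Lemma ae_le_Rintegral f g : mu.-integrable setT (EFin \o f) ->
  mu.-integrable setT (EFin \o g) -> {ae mu, forall x, f x <= g x} ->
  \int[mu]_x f x <= \int[mu]_x g x.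
Proof.
move=> fi gi fg; rewrite -subr_ge0 -RintegralB//.
have mgf : measurable_fun setT (fun x => g x - f x).
  by apply/measurable_EFinP; exact: measurable_int (integrableB measurableT gi fi).
(* The difference agrees almost everywhere with its absolute value. *)
rewrite (_ : \int[mu]_x _ = \int[mu]_x `|g x - f x|); first exact: Rintegral_ge0.
congr fine; apply: ae_eq_integral => //.
- exact/measurable_EFinP.
- by apply/measurable_EFinP; exact: measurableT_comp.
by apply: filterS fg => x fgx _; rewrite ger0_norm// subr_ge0.
Qed.

Lemma L2_mul_integrable f g : L2 mu f -> L2 mu g ->
  mu.-integrable setT (fun x => (f x * g x)%:E).
Proof.
move=> [mf f2] [mg g2].
apply: le_integrable (integrableD measurableT f2 g2) => //.
  by apply/measurable_EFinP; exact: measurable_funM.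
move=> x _; rewrite -EFinD lee_fin [leRHS]ger0_norm ?addr_ge0 ?sqr_ge0//.
have [fg|fg] := leP 0 (f x * g x).
  by rewrite ger0_norm//; nra.
by rewrite ltr0_norm//; nra.
Qed.

Lemma L2_cst (c : R) : L2 mu (cst c).
Proof.
split => //.
by apply: (@finite_measure_integrable_cst _ _ _ mu setT (c ^+ 2)).
Qed.

Lemma L2_lin (a b : R) f g : L2 mu f -> L2 mu g ->
  L2 mu (fun x => a * f x + b * g x).
Proof.
move=> Lf Lg; have [[mf f2] [mg g2]] := (Lf, Lg); split.
  by apply: measurable_funD; apply: measurable_funM.
have fg := L2_mul_integrable Lf Lg.
rewrite (_ : (fun x => _) = (fun x => (a ^+ 2)%:E * (f x ^+ 2)%:E +
  (2 * a * b)%:E * (f x * g x)%:E + (b ^+ 2)%:E * (g x ^+ 2)%:E)%E).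
  by do ![apply: integrableD => //|apply: integrableZl => //].
by apply/funext => x; rewrite -!EFinM -!EFinD; congr EFin; ring.
Qed.

Lemma L2_integrable f : L2 mu f -> mu.-integrable setT (EFin \o f).
Proof.
move=> Lf; have := L2_mul_integrable Lf (L2_cst 1).
by under eq_fun do rewrite mulr1.
Qed.

Lemma dotpC f g : dotp f g = dotp g f.
Proof. by apply: eq_Rintegral => x _; rewrite mulrC. Qed.

Lemma dotp_linl (a b : R) f g h : L2 mu f -> L2 mu g -> L2 mu h ->
  dotp (fun x => a * f x + b * g x) h = a * dotp f h + b * dotp g h.
Proof.
move=> Lf Lg Lh; have fh := L2_mul_integrable Lf Lh.
have gh := L2_mul_integrable Lg Lh.
rewrite /dotp -!RintegralZl// -RintegralD//.
- by apply: eq_Rintegral => x _; ring.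
- exact: (integrableZl measurableT a fh).
- exact: (integrableZl measurableT b gh).
Qed.

Lemma dotp_linr (a b : R) f g h : L2 mu f -> L2 mu g -> L2 mu h ->
  dotp h (fun x => a * f x + b * g x) = a * dotp h f + b * dotp h g.
Proof. by move=> Lf Lg Lh; rewrite dotpC dotp_linl// !(dotpC h). Qed.

Lemma dotp_ge0 f : 0 <= dotp f f.
Proof. by apply: Rintegral_ge0 => x _; rewrite -expr2 sqr_ge0. Qed.

Lemma dotp_EFin f : L2 mu f -> (\int[mu]_x (f x ^+ 2)%:E = (dotp f f)%:E)%E.
Proof.
move=> [_ f2]; rewrite -(fineK (integrable_fin_num measurableT f2)).
by congr (fine _)%:E; apply: eq_integral => x _; rewrite expr2.
Qed.

Lemma CauchySchwarz f g : L2 mu f -> L2 mu g ->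
  dotp f g ^+ 2 <= dotp f f * dotp g g.
Proof.
move=> Lf Lg; apply: discriminant_le => [|t]; first exact: dotp_ge0.
have := dotp_ge0 (fun x => 1 * f x + t * g x).
have L := L2_lin 1 t Lf Lg.
rewrite dotp_linl// !dotp_linr// (dotpC g f) => /le_trans; apply.
by rewrite le_eqVlt; apply/orP; left; apply/eqP; ring.
Qed.

(** The triangle inequality of the L^2 norm, stated on squares so that no square root appears. *)
Lemma dotp_triangle f g (a b : R) : L2 mu f -> L2 mu g -> 0 <= a -> 0 <= b ->
  dotp f f <= a ^+ 2 -> dotp g g <= b ^+ 2 ->
  dotp (fun x => 1 * f x + 1 * g x) (fun x => 1 * f x + 1 * g x) <= (a + b) ^+ 2.
Proof.
move=> Lf Lg a0 b0 fa gb; rewrite dotp_linl// ?dotp_linr//; last exact: L2_lin.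
rewrite (dotpC g f).
have fg : dotp f g <= a * b.
  rewrite (le_trans (ler_norm _))// -ler_sqr ?nnegrE ?mulr_ge0//.
  rewrite real_normK ?num_real// (le_trans (CauchySchwarz Lf Lg))// exprMn.
  by rewrite ler_pM ?dotp_ge0.
by nra.
Qed.

Lemma dotp_eq0 f : L2 mu f -> dotp f f = 0 -> {ae mu, forall x, f x = 0}.
Proof.
move=> Lf ff0; have [mf _] := Lf.
have : (\int[mu]_x `|(f x ^+ 2)%:E| = 0)%E.
  under eq_integral do rewrite gee0_abs ?lee_fin ?sqr_ge0//.
  by rewrite dotp_EFin// ff0.
move/ae_eq_integral_abs => /(_ measurableT) ae0.
have {}ae0 : ae_eq mu setT (fun x => (f x ^+ 2)%:E) (cst 0%E).
  by apply: ae0; apply/measurable_EFinP; exact: measurable_funX.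
by apply: filterS ae0 => x /(_ I) [/eqP]; rewrite sqrf_eq0 => /eqP.
Qed.

(** Cauchy-Schwarz against the constant 1. The right side may be infinite, so that the bound can be
    applied to [m x] at every [x]. *)
Lemma Rintegral_sqr_le f : measurable_fun setT f ->
  (((\int[mu]_x f x) ^+ 2)%:E <= \int[mu]_x (f x ^+ 2)%:E)%E.
Proof.
move=> mf; have [foo|] := ltP (\int[mu]_x (f x ^+ 2)%:E)%E +oo%E; last first.
  by rewrite leye_eq => /eqP ->; rewrite leey.
have Lf : L2 mu f.
  split => //; apply/integrableP; split.
    by apply/measurable_EFinP; exact: measurable_funX.
  by under eq_integral do rewrite gee0_abs ?lee_fin ?sqr_ge0//.
rewrite dotp_EFin// lee_fin; have := CauchySchwarz Lf (L2_cst 1).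
rewrite /dotp /=; under eq_Rintegral do rewrite mulr1.
under [X in _ <= _ * X]eq_Rintegral do rewrite mulr1.
by rewrite Rintegral_prob_cst mulr1.
Qed.

End L2_space.

(** * Completeness of L^2 along sequences with geometrically small increments *)

Section L2_completeness.
Context {R : realType} {d : measure_display} {T : measurableType d}.
Variable mu : probability T R.
Variables (f : nat -> T -> R) (C q : R).
Hypothesis Lf : forall k, L2 mu (f k).
Hypotheses (C0 : 0 <= C) (q0 : 0 <= q) (q1 : q < 1).

(* Differences have the shape [a * f + b * g] of [L2_lin] and [dotp_linl]. *)
Let step k x := 1 * f k.+1 x + (-1) * f k x.
Hypothesis step_le : forall k, dotp mu (step k) (step k) <= (C * q ^+ k) ^+ 2.

Let Lstep k : L2 mu (step k). Proof. exact: L2_lin. Qed.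

Let subq_gt0 : 0 < 1 - q. Proof. by rewrite subr_gt0. Qed.

Let geo_ge0 k : 0 <= C * q ^+ k. Proof. by rewrite mulr_ge0 ?exprn_ge0. Qed.

(** The factor [(1 - q ^+ n) / (1 - q)] is the exact partial geometric sum, which lets the induction
    on [n] close. *)
Let tail_le k n :
  dotp mu (fun x => 1 * f (k + n)%N x + (-1) * f k x)
          (fun x => 1 * f (k + n)%N x + (-1) * f k x)
  <= (C * q ^+ k * (1 - q ^+ n) / (1 - q)) ^+ 2.
Proof.
elim: n => [|n IH].
  rewrite addn0 expr0 subrr mulr0 mul0r expr0n /dotp.
  under eq_Rintegral do rewrite mulN1r mul1r subrr mulr0.
  by rewrite Rintegral_prob_cst.
have a0 : 0 <= C * q ^+ k * (1 - q ^+ n) / (1 - q).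
  apply: divr_ge0 (ltW subq_gt0); apply: mulr_ge0 => //.
  by rewrite subr_ge0 exprn_ile1// ltW.
have L : L2 mu (fun x => 1 * f (k + n)%N x + (-1) * f k x) by exact: L2_lin.
have := dotp_triangle L (Lstep (k + n)) a0 (geo_ge0 (k + n)) IH (step_le (k + n)).
rewrite (_ : C * q ^+ k * (1 - q ^+ n) / (1 - q) + C * q ^+ (k + n) =
  C * q ^+ k * (1 - q ^+ n.+1) / (1 - q)).
  apply: le_trans; rewrite le_eqVlt; apply/orP; left; apply/eqP.
  by apply: eq_Rintegral => x _; rewrite /step addnS; ring.
by rewrite exprD exprS; field; rewrite gt_eqF.
Qed.

Let tail_bound k n :
  dotp mu (fun x => 1 * f (k + n)%N x + (-1) * f k x)
          (fun x => 1 * f (k + n)%N x + (-1) * f k x)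
  <= (C * q ^+ k / (1 - q)) ^+ 2.
Proof.
apply: le_trans (tail_le k n) _.
have qn0 : 0 <= q ^+ n by rewrite exprn_ge0.
have qn1 : q ^+ n <= 1 by rewrite exprn_ile1// ltW.
rewrite ler_sqr ?nnegrE.
- rewrite ler_pM2r ?invr_gt0// -[leRHS]mulr1 ler_wpM2l//; lra.
- by rewrite divr_ge0 ?mulr_ge0 ?(ltW subq_gt0)// ?exprn_ge0// subr_ge0.
- by rewrite divr_ge0 ?(ltW subq_gt0).
Qed.

(** On a probability space the L^1 norm is at most the L^2 norm, so the sum of the [|step k|] is
    integrable, hence finite almost everywhere, and the telescoping series converges absolutely
    there. *)
Let ae_cvg : {ae mu, forall x, cvgn (f ^~ x)}.
Proof.
pose v k x := (`|step k x|)%:E.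
have mv k : measurable_fun setT (v k).
  by apply/measurable_EFinP; apply: measurableT_comp => //; case: (Lstep k).
have v0 k x : (0 <= v k x)%E by rewrite lee_fin.
have vle k : (\int[mu]_x v k x <= (C * q ^+ k)%:E)%E.
  have iv : mu.-integrable setT (v k).
    by apply: integrable_norm; exact: L2_integrable.
  rewrite -(fineK (integrable_fin_num measurableT iv)) lee_fin.
  rewrite -ler_sqr ?nnegrE ?fine_ge0 ?integral_ge0//.
  apply: le_trans (step_le k); rewrite -lee_fin -dotp_EFin//.
  under [leRHS]eq_integral do rewrite -real_normK ?num_real//.
  by apply: Rintegral_sqr_le; apply: measurableT_comp => //; case: (Lstep k).
have isum : mu.-integrable setT (fun x => \sum_(0 <= k <oo) v k x)%E.
  apply/integrableP; split; first exact: ge0_emeasurable_sum.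
  under eq_integral do rewrite gee0_abs ?nneseries_ge0//.
  rewrite integral_nneseries//.
  apply: (@le_lt_trans _ _ (\sum_(0 <= k <oo) (C * q ^+ k)%:E)%E).
    by apply: lee_nneseries => // k _; rewrite ?integral_ge0.
  apply: (@le_lt_trans _ _ (C / (1 - q))%:E); last by rewrite ltry.
  apply: lime_le; first by apply: is_cvg_nneseries => k _ _; rewrite lee_fin.
  apply: nearW => n; rewrite sumEFin lee_fin -mulr_sumr ler_wpM2l//.
  have -> : \sum_(0 <= i < n) q ^+ i = (1 - q ^+ n) / (1 - q).
    apply: (@mulIf _ (1 - q)); rewrite ?gt_eqF// divfK ?gt_eqF//.
    elim: n => [|n IH]; first by rewrite big_geq// mul0r expr0 subrr.
    by rewrite big_nat_recr//= mulrDl IH exprS; ring.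
  by rewrite -[leRHS]mul1r ler_wpM2r ?invr_ge0 ?(ltW subq_gt0)// gerBl exprn_ge0.
apply: filterS (integrable_ae measurableT isum) => x /(_ I) sfin.
have cs : cvgn (series (fun k => step k x)).
  apply: normed_cvg; apply: nondecreasing_is_cvgn.
    by apply: nondecreasing_series => k _ _ /=; rewrite normr_ge0.
  exists (fine (\sum_(0 <= k <oo) v k x)%E) => _ [n _ <-].
  rewrite -lee_fin fineK//= /series/= -sumEFin.
  exact: nneseries_lim_ge.
have -> : f ^~ x = (fun n => f 0%N x + series (fun k => step k x) n).
  apply/funext; elim => [|n IH]; first by rewrite /series/= big_geq// addr0.
  by rewrite /series/= big_nat_recr//= addrA -IH /step; ring.
by apply: is_cvgD => //; exact: is_cvg_cst.
Qed.

Lemma L2_complete : exists2 g, L2 mu g & forall k,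
  dotp mu (fun x => 1 * g x + (-1) * f k x) (fun x => 1 * g x + (-1) * f k x)
  <= (C * q ^+ k / (1 - q)) ^+ 2.
Proof.
(* The limsup is measurable on all of [T] and is the pointwise limit almost everywhere. *)
pose g x := fine (limn_esup (fun k => (f k x)%:E)).
have mf k : measurable_fun setT (f k) by case: (Lf k).
have mg : measurable_fun setT g.
  apply: measurableT_comp => //; apply: measurable_fun_limn_esup => k.
  exact/measurable_EFinP.
have fg : {ae mu, forall x, f ^~ x @ \oo --> g x}.
  apply: filterS ae_cvg => x cf.
  have /cvg_limn_einf_sup[_ E] : (fun k => (f k x)%:E) @ \oo --> (limn (f ^~ x))%:E.
    by apply: cvg_EFin; [exact: nearW|exact: cf].
  by rewrite /g E.
have gle k : (\int[mu]_x ((1 * g x + (-1) * f k x) ^+ 2)%:E <=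
    ((C * q ^+ k / (1 - q)) ^+ 2)%:E)%E.
  (* Fatou's lemma in [n] carries [tail_bound] over to the limit. *)
  pose h n x := ((1 * f (k + n)%N x + (-1) * f k x) ^+ 2)%:E.
  have mh n : measurable_fun setT (h n).
    apply/measurable_EFinP; apply: measurable_funX.
    by case: (L2_lin 1 (-1) (Lf (k + n)) (Lf k)).
  have h0 n x : (0 <= h n x)%E by rewrite lee_fin sqr_ge0.
  rewrite (_ : (\int[mu]_x _)%E = (\int[mu]_x limn_einf (h ^~ x))%E).
    apply: le_trans (fatou mu measurableT mh (fun n x _ => h0 n x)) _.
    rewrite limn_einf_lim; apply: lime_le; first exact: is_cvg_einfs.
    apply: nearW => n; apply: (@le_trans _ _ (\int[mu]_x h n x)%E).
      by apply: ereal_inf_lbound; exists n => /=.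
    by rewrite dotp_EFin ?lee_fin//; exact: L2_lin.
  apply: ge0_ae_eq_integral => //.
  - apply/measurable_EFinP; apply: measurable_funX.
    by apply: measurable_funD; exact: measurable_funM.
  - apply: measurableT_comp => //; apply: measurable_fun_limn_esup => n.
    exact: measurableT_comp.
  - by move=> x _; rewrite lee_fin sqr_ge0.
  - move=> x _; rewrite limn_einf_lim; apply: lime_ge; first exact: is_cvg_einfs.
    by apply: nearW => n; apply: le_ereal_inf_tmp => _ [j _ <-]; exact: h0.
  apply: filterS fg => x fgx _; apply/esym.
  apply: (cvg_limn_einf_sup _).1; apply: cvg_EFin; first exact: nearW.
  suff : (fun n => 1 * f (k + n)%N x + -1 * f k x) @ \oo --> 1 * g x + -1 * f k x.
    by move=> c; exact: (cvgM c c).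
  apply: cvgD; last exact: cvg_cst.
  apply: cvgMl_tmp; under eq_fun do rewrite addnC.
  by have := fgx; rewrite -(cvg_shiftn k (f ^~ x)).
have Lgf : L2 mu (fun x => 1 * g x + (-1) * f 0%N x).
  have mgf : measurable_fun setT (fun x => 1 * g x + (-1) * f 0%N x).
    by apply: measurable_funD; exact: measurable_funM.
  split => //; apply/integrableP; split.
    by apply/measurable_EFinP; exact: measurable_funX.
  under eq_integral do rewrite gee0_abs ?lee_fin ?sqr_ge0//.
  by apply: le_lt_trans (gle 0%N) _; rewrite ltry.
have Lg : L2 mu g.
  have := L2_lin 1 1 Lgf (Lf 0%N); congr (L2 mu _); apply/funext => x; ring.
exists g => // k; rewrite -lee_fin -dotp_EFin//; exact: L2_lin.
Qed.

End L2_completeness.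

(** * Energy of a reversible walk *)

Section kernel_measure.
Context {R : realType} {d1 d2 : measure_display}.
Context {X : measurableType d1} {Y : measurableType d2}.
Variable m : R.-pker X ~> Y.

(* Carries the probability structure, for which [m x] has no instance. *)
Definition kernel_measure (x : X) : set Y -> \bar R := m x.

HB.instance Definition _ x := Measure.on (kernel_measure x).
HB.instance Definition _ x :=
  Measure_isProbability.Build _ _ _ (kernel_measure x) (prob_kernel x).

End kernel_measure.

Section reversible_walk.
Context {R : realType} {d : measure_display} {T : measurableType d}.
Variables (m : R.-pker T ~> T) (nu : probability T R).
Hypothesis Hrev : nu_reversible m nu.
Implicit Types f g h : T -> R.

Local Notation J := (joint nu m).

Let measurable_swap_pair : measurable_fun setT (@swap_pair T T).
Proof. exact: measurable_swap. Qed.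

(** Reversibility is this symmetry on rectangles, a generating class closed under intersection on
    which a finite measure is determined. *)
Lemma joint_swap (A : set (T * T)) : measurable A ->
  pushforward J swap_pair A = J A.
Proof.
move=> mA.
unshelve apply: (measure_unique [set A `*` B | A in measurable & B in measurable]
  (fun=> setT) _ _ _ _ (pushforward J swap_pair)) => //.
- exact: measurable_prod_measurableType.
- move=> _ _ [A1 mA1 [B1 mB1 <-]] [A2 mA2 [B2 mB2 <-]].
  by rewrite -setXI; exists (A1 `&` A2); [exact: measurableI|exists (B1 `&` B2) => //;
    exact: measurableI].
- by move=> _; exists setT => //; exists setT => //; rewrite setXTT.
- by rewrite bigcup_const.
- move=> _ [A1 mA1 [B1 mB1 <-]]; transitivity (J (B1 `*` A1)).
    by congr (J _); apply/seteqP; split => -[x y] [].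
  apply: etrans (joint_setX nu m mB1 mA1) _; rewrite Hrev//.
  exact/esym/joint_setX.
- by move=> _; rewrite /= /pushforward preimage_setT [ltLHS]probability_setT ltry.
Qed.

Lemma ge0_integral_joint_swap (k : T * T -> \bar R) :
  (forall z, 0 <= k z)%E -> measurable_fun setT k ->
  (\int[J]_z k (swap_pair z) = \int[J]_z k z)%E.
Proof.
move=> k0 mk; transitivity (\int[pushforward J swap_pair]_z k z)%E.
  by apply/esym; exact: ge0_integral_pushforward.
by apply: eq_measure_integral => A mA _; exact: joint_swap.
Qed.

Lemma integrable_joint_swap (k : T * T -> R) :
  J.-integrable setT (EFin \o k) -> J.-integrable setT (EFin \o (k \o swap_pair)).
Proof.
move=> ik; have mk := measurable_int _ ik; case/integrableP : ik => _ kfin.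
apply/integrableP; split; first exact: (measurableT_comp mk measurable_swap_pair).
apply: le_lt_trans kfin; rewrite le_eqVlt; apply/orP; left; apply/eqP.
apply: (@ge0_integral_joint_swap (abse \o (EFin \o k))) => [z|].
  exact: abse_ge0.
exact: measurableT_comp.
Qed.

Lemma Rintegral_joint_swap (k : T * T -> R) : J.-integrable setT (EFin \o k) ->
  \int[J]_z k (swap_pair z) = \int[J]_z k z.
Proof.
move=> ik; have mk := measurable_int _ ik; congr fine.
transitivity (\int[pushforward J swap_pair]_z (k z)%:E)%E.
  apply/esym; apply: integral_pushforward => //.
  exact: integrable_joint_swap.
by apply: eq_measure_integral => A mA _; exact: joint_swap.
Qed.

Lemma integrable_joint_fst h : nu.-integrable setT (EFin \o h) ->
  J.-integrable setT (EFin \o (h \o fst)).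
Proof.
move=> ih; have mh := measurable_int _ ih; case/integrableP : ih => _ hfin.
have mh1 : measurable_fun [set: T * T] (EFin \o (h \o fst)).
  exact: (measurableT_comp mh measurable_fst).
apply/integrableP; split => //; apply: le_lt_trans hfin.
rewrite le_eqVlt; apply/orP; left; apply/eqP.
rewrite (@ge0_integral_joint _ _ _ _ _ nu m (fun z => `|(h z.1)%:E|%E))//.
  apply: eq_integral => x _; rewrite -[LHS]/(\int[m x]_y cst `|(h x)%:E| y)%E.
  by rewrite integral_cst// [X in (_ * X)%E]prob_kernel mule1.
exact: measurableT_comp.
Qed.

Lemma L2_joint_fst f : L2 nu f -> L2 J (f \o fst).
Proof.
move=> [mf f2]; split; first exact: measurableT_comp.
exact: (integrable_joint_fst (h := fun x => f x ^+ 2)).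
Qed.

(** Transported from the first coordinate by the symmetry of [J]. *)
Lemma L2_joint_snd f : L2 nu f -> L2 J (f \o snd).
Proof.
move=> Lf; have [mf1 f2] := L2_joint_fst Lf; split.
  by case: Lf => mf _; exact: measurableT_comp.
exact: (integrable_joint_swap (k := fun z => f z.1 ^+ 2)).
Qed.

Definition grad f (z : T * T) : R := f z.2 - f z.1.

Lemma L2_grad f : L2 nu f -> L2 J (grad f).
Proof.
move=> Lf; have := L2_lin 1 (-1) (L2_joint_snd Lf) (L2_joint_fst Lf).
by congr (L2 _ _); apply/funext => z; rewrite /grad /=; ring.
Qed.

Definition energy f g : R := dotp J (grad f) (grad g) / 2.

Let Lap_sqr_le_grad f : measurable_fun setT f ->
  forall x, ((Lap m f x ^+ 2)%:E <= \int[m x]_y (grad f (x, y) ^+ 2)%:E)%E.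
Proof.
move=> mf x.
apply: (@Rintegral_sqr_le _ _ _ (kernel_measure m x) (fun y => f y - f x)).
exact: measurable_funB.
Qed.

Let measurable_Lap f : L2 nu f -> measurable_fun setT (Lap m f).
Proof. by move=> /L2_grad/L2_integrable; exact: measurable_section_integral. Qed.

Let integral_grad_sqr f : L2 nu f ->
  (\int[nu]_x \int[m x]_y (grad f (x, y) ^+ 2)%:E = (2 * energy f f)%:E)%E.
Proof.
move=> /L2_grad LD; rewrite /energy mulrCA divff// mulr1 -dotp_EFin//.
rewrite (ge0_integral_joint nu m (f := fun z => (grad f z ^+ 2)%:E))//.
  by move=> z; rewrite lee_fin sqr_ge0.
by apply/measurable_EFinP; apply: measurable_funX; case: LD.
Qed.

Let integral_Lap_sqr_le f : L2 nu f ->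
  (\int[nu]_x (Lap m f x ^+ 2)%:E <= (2 * energy f f)%:E)%E.
Proof.
move=> Lf; have [mf _] := Lf; have [mD _] := L2_grad Lf.
rewrite -integral_grad_sqr//; apply: ge0_le_integral => //.
- by move=> x _; rewrite lee_fin sqr_ge0.
- by apply/measurable_EFinP; apply: measurable_funX; exact: measurable_Lap.
- apply: (measurable_fun_integral_finite_kernel (fun z => (grad f z ^+ 2)%:E) m).
    by move=> z; rewrite lee_fin sqr_ge0.
  by apply/measurable_EFinP; exact: measurable_funX.
- by move=> x _; exact: Lap_sqr_le_grad.
Qed.

Lemma L2_Lap f : L2 nu f -> L2 nu (Lap m f).
Proof.
move=> Lf; have mL := measurable_Lap Lf.
split => //; apply/integrableP; split.
  by apply/measurable_EFinP; exact: measurable_funX.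
under eq_integral do rewrite gee0_abs ?lee_fin ?sqr_ge0//.
by apply: le_lt_trans (integral_Lap_sqr_le Lf) _; rewrite ltry.
Qed.

(** In operator terms, [- Lap] has its spectrum in [0, 2]. This is what makes the half step in
    [relax] non-expansive. *)
Lemma dotp_Lap_le f : L2 nu f -> dotp nu (Lap m f) (Lap m f) <= 2 * energy f f.
Proof.
move=> Lf; rewrite -lee_fin -dotp_EFin; last exact: L2_Lap.
exact: integral_Lap_sqr_le.
Qed.

Lemma Hm_EFin f : L2 nu f -> Hm m nu f = (energy f f)%:E.
Proof.
move=> Lf; rewrite /Hm; under eq_integral => x _.
  under eq_integral do rewrite -[_ - _]/(grad f (x, _)).
  over.
by rewrite integral_grad_sqr// -EFinM mulrA mulVf// mul1r.
Qed.

Lemma green f g : L2 nu f -> L2 nu g -> dotp nu f (Lap m g) = - energy f g.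
Proof.
move=> Lf Lg; have LD := L2_grad Lg.
have Lf1 := L2_joint_fst Lf; have Lf2 := L2_joint_snd Lf.
have i1 := L2_mul_integrable Lf1 LD.
have -> : dotp nu f (Lap m g) = dotp J (f \o fst) (grad g).
  rewrite /dotp -Rintegral_joint//; congr fine; apply: ae_eq_integral => //.
  - apply/measurable_EFinP; apply: measurable_funM; first by case: Lf.
    exact: measurable_Lap.
  - by apply/measurable_EFinP; exact: measurable_section_integral i1.
  apply: filterS (ae_integrable_section (L2_integrable LD)) => x ix _ /=.
  by congr EFin; rewrite -RintegralZl.
(* [grad g] changes sign under the swap, so both coordinates contribute equally to the energy. *)
have swapE : dotp J (f \o fst) (grad g) = - dotp J (f \o snd) (grad g).
  rewrite /dotp -(Rintegral_joint_swap i1) -mulN1r -RintegralZl//.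
    by apply: eq_Rintegral => z _; rewrite /grad /=; ring.
  exact: L2_mul_integrable.
have -> : energy f g = (dotp J (f \o snd) (grad g) - dotp J (f \o fst) (grad g)) / 2.
  congr (_ / _); have := dotp_linl 1 (-1) Lf2 Lf1 LD; rewrite mul1r mulN1r => <-.
  by apply: eq_Rintegral => z _; rewrite /grad /=; ring.
by rewrite swapE; field.
Qed.

(** Stated for L^1 because it is applied to products of L^2 functions and to [Gamma m f f], which
    are only integrable. *)
Lemma Lap_L1 h : nu.-integrable setT (EFin \o h) ->
  nu.-integrable setT (EFin \o Lap m h) /\ \int[nu]_x Lap m h x = 0.
Proof.
move=> ih; have i1 := integrable_joint_fst ih.
have i2 := integrable_joint_swap i1.
have iD : J.-integrable setT (EFin \o grad h).
  by have := integrableB measurableT i2 i1.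
split; first exact: integrable_section_integral iD.
rewrite (Rintegral_joint iD) /grad RintegralB//.
by rewrite (Rintegral_joint_swap i1) subrr.
Qed.

Lemma energyC f g : energy f g = energy g f.
Proof. by rewrite /energy dotpC. Qed.

Lemma energy_ge0 f : 0 <= energy f f.
Proof. by rewrite divr_ge0 ?dotp_ge0. Qed.

Let grad_lin (a b : R) f g : grad (fun x => a * f x + b * g x) =
  (fun z => a * grad f z + b * grad g z).
Proof. by apply/funext => z; rewrite /grad; ring. Qed.

Lemma energy_linr (a b : R) f g h : L2 nu f -> L2 nu g -> L2 nu h ->
  energy h (fun x => a * f x + b * g x) = a * energy h f + b * energy h g.
Proof.
move=> /L2_grad Lf /L2_grad Lg /L2_grad Lh.
by rewrite /energy grad_lin dotp_linr//; field.
Qed.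

Lemma energy_cst (c : R) f : energy f (cst c) = 0.
Proof.
rewrite /energy /dotp; under eq_Rintegral do rewrite /grad /= subrr mulr0.
by rewrite Rintegral_prob_cst mul0r.
Qed.

Lemma energy_CauchySchwarz f g : L2 nu f -> L2 nu g ->
  energy f g ^+ 2 <= energy f f * energy g g.
Proof.
move=> /L2_grad Lf /L2_grad Lg; rewrite /energy.
by have := CauchySchwarz Lf Lg; nra.
Qed.

(** * Centering, the Poincare inequality and the integrated condition *)

Definition center f x : R := f x - \int[nu]_y f y.

Lemma grad_center f : grad (center f) = grad f.
Proof. by apply/funext => z; rewrite /grad /center; ring. Qed.

Lemma Lap_center f : Lap m (center f) = Lap m f.
Proof.
apply/funext => x; apply: eq_Rintegral => y _; rewrite /center; ring.
Qed.

Lemma L2_center f : L2 nu f -> L2 nu (center f).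
Proof.
move=> Lf; have := L2_lin 1 (- \int[nu]_y f y) Lf (L2_cst nu 1).
by congr L2; apply/funext => x; rewrite /center /=; ring.
Qed.

Lemma Rintegral_center f : L2 nu f -> \int[nu]_x center f x = 0.
Proof.
move=> Lf; rewrite /center RintegralB//; last 2 first.
- exact: L2_integrable.
- exact: L2_integrable (L2_cst nu _).
by rewrite Rintegral_prob_cst subrr.
Qed.

Lemma Var_EFin f : L2 nu f -> Var nu f = (dotp nu (center f) (center f))%:E.
Proof. by move=> Lf; rewrite -dotp_EFin//; exact: L2_center. Qed.

Lemma poincareP (lam : R) : poincare m nu lam <->
  forall f, L2 nu f -> lam * dotp nu (center f) (center f) <= energy f f.
Proof.
split=> P f Lf; have := P f Lf;
  by rewrite Var_EFin// Hm_EFin// -EFinM lee_fin.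
Qed.

(** Common form of [IBE] and [IBE_inf]. In operator terms, the spectrum of [- Lap] avoids the open
    interval from 0 to [lam]. *)
Definition gapped (lam : R) := forall f, L2 nu f ->
  lam * energy f f <= dotp nu (Lap m f) (Lap m f).

Lemma gappedP (lam : R) : gapped lam <-> forall f, L2 nu f ->
  (lam%:E * Hm m nu f <= \int[nu]_x ((Lap m f x) ^+ 2)%:E)%E.
Proof.
split=> P f Lf; have := P f Lf;
  by rewrite dotp_EFin ?Hm_EFin// -?EFinM ?lee_fin//; exact: L2_Lap.
Qed.

Lemma poincare_gapped (lam : R) : 0 < lam -> poincare m nu lam -> gapped lam.
Proof.
move=> lam0 /poincareP P f Lf; have LL := L2_Lap Lf; have Lc := L2_center Lf.
have := CauchySchwarz Lc LL; rewrite -Lap_center green// sqrrN.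
rewrite /energy grad_center -/(energy f f) Lap_center.
have := P f Lf; have := energy_ge0 f; have := dotp_ge0 nu (Lap m f).
have := dotp_ge0 nu (center f).
set E := energy f f; set V := dotp _ _ _; set N := dotp _ _ _ => V0 N0.
rewrite le_eqVlt => /predU1P[<-|E0] lE EE; first by rewrite mulr0.
(* From [E ^+ 2 <= V * N] and [lam * V <= E]; one factor [E] cancels. *)
rewrite -(ler_pM2l E0); apply: (@le_trans _ _ (lam * (V * N))); nra.
Qed.

Lemma poincare_le_gap (lam : R) : poincare m nu lam -> (lam%:E <= gap m nu)%E.
Proof.
move=> /poincareP P; apply: le_ereal_inf_tmp => _ [f [Lf V0] <-].
rewrite lee_fin Hm_EFin//= Var_EFin//= ler_pdivlMr; first exact: P.
by rewrite lt_neqAle dotp_ge0 andbT eq_sym; move: V0; rewrite Var_EFin.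
Qed.

(** * Integrals of the carre du champ and of its iterate *)

Lemma Gamma_Rintegral f g : L2 nu f -> L2 nu g ->
  nu.-integrable setT (EFin \o Gamma m f g) /\
  \int[nu]_x Gamma m f g x = energy f g.
Proof.
move=> Lf Lg; have [iL L0] := Lap_L1 (L2_mul_integrable Lf Lg).
have ifg := L2_mul_integrable Lf (L2_Lap Lg).
have igf := L2_mul_integrable Lg (L2_Lap Lf).
have i1 := integrableB measurableT iL ifg.
have i2 := integrableB measurableT i1 igf.
split.
  have := integrableZr measurableT 2^-1 i2; congr (integrable _ _ _).
rewrite /Gamma RintegralZr// RintegralB// RintegralB// L0.
rewrite -/(dotp nu f (Lap m g)) -/(dotp nu g (Lap m f)) !green// (energyC g).
by field.
Qed.

Lemma Gamma2_Rintegral f : L2 nu f ->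
  nu.-integrable setT (EFin \o Gamma2 m f) /\
  \int[nu]_x Gamma2 m f x = dotp nu (Lap m f) (Lap m f).
Proof.
move=> Lf; have LL := L2_Lap Lf.
have [iG _] := Gamma_Rintegral Lf Lf.
have [iL L0] := Lap_L1 iG.
have [iGL GL] := Gamma_Rintegral Lf LL.
have i1 := integrableZr measurableT 2^-1 iL.
split; first by have := integrableB measurableT i1 iGL; congr (integrable _ _ _).
by rewrite /Gamma2 RintegralB// RintegralZr// L0 GL green// energyC; ring.
Qed.

(** Here [a] stands for [n^-1], and [a = 0] covers infinite dimension. *)
Lemma integrated_BE (a K : R) f : L2 nu f ->
  {ae nu, forall x, Lap m f x ^+ 2 * a + K * Gamma m f f x <= Gamma2 m f x} ->
  K * energy f f <= (1 - a) * dotp nu (Lap m f) (Lap m f).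
Proof.
move=> Lf; have LL := L2_Lap Lf.
have [iG G] := Gamma_Rintegral Lf Lf; have [iG2 G2] := Gamma2_Rintegral Lf.
have [_ iL2] := LL.
have i1 := integrableZr measurableT a iL2.
have i2 := integrableZl measurableT K iG.
move=> /(ae_le_Rintegral (integrableD measurableT i1 i2) iG2).
rewrite RintegralD// RintegralZr// RintegralZl// G G2.
rewrite (_ : \int[nu]_x _ = dotp nu (Lap m f) (Lap m f)); last first.
  by apply: eq_Rintegral => x _; rewrite expr2.
by lra.
Qed.

(** * From the integrated condition to the Poincare inequality *)

(** By Green's formula and Cauchy-Schwarz [N ^+ 2 <= E' * E], while the hypothesis gives
    [lam * E <= N]; one factor [N] then cancels. *)
Lemma gapped_Lap (lam : R) f : 0 < lam -> gapped lam -> L2 nu f ->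
  lam * dotp nu (Lap m f) (Lap m f) <= energy (Lap m f) (Lap m f).
Proof.
move=> lam0 G Lf; have LL := L2_Lap Lf.
have := energy_CauchySchwarz LL Lf; have := green LL Lf; have := G _ Lf.
have := energy_ge0 f; have := energy_ge0 (Lap m f).
have := dotp_ge0 nu (Lap m f).
set N := dotp _ _ _; set E := energy f f; set E' := energy _ _.
rewrite le_eqVlt => /predU1P[<-|N0] E'0 E0 lE NE CS; first by rewrite mulr0.
have NN : N ^+ 2 <= E' * E by rewrite NE sqrrN.
rewrite -(ler_pM2l N0); apply: (@le_trans _ _ (lam * (E' * E))).
  by rewrite mulrCA -expr2 ler_pM2l.
by rewrite mulrCA [leRHS]mulrC ler_wpM2l.
Qed.

(** Where [f] is [m x]-integrable this averages [f x] with the [m x]-mean of [f]: one step of the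
    lazy walk. *)
Definition relax f x : R := 1 * f x + 2^-1 * Lap m f x.

Lemma L2_relax f : L2 nu f -> L2 nu (relax f).
Proof. by move=> Lf; apply: L2_lin => //; exact: L2_Lap. Qed.

Lemma dotp_relaxr f g : L2 nu f -> L2 nu g ->
  dotp nu g (relax f) = dotp nu g f - energy g f / 2.
Proof.
by move=> Lf Lg; rewrite /relax dotp_linr ?green//; [field|exact: L2_Lap].
Qed.

(** By Green's formula the left side is [|f|^2 - E(f, f) + |Lap f|^2 / 4], and [dotp_Lap_le] bounds
    the last term by half the energy. *)
Lemma dotp_relax_le f : L2 nu f ->
  dotp nu (relax f) (relax f) <= dotp nu f f - energy f f / 2.
Proof.
move=> Lf; have LL := L2_Lap Lf; have LR := L2_relax Lf.
rewrite {1}/relax dotp_linl// !dotp_relaxr// (dotpC _ (Lap m f)) green//.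
have -> : energy (Lap m f) f = - dotp nu (Lap m f) (Lap m f).
  by rewrite green// opprK.
by have := dotp_Lap_le Lf; lra.
Qed.

(* [Lap] is additive only where the functions are [m_x]-integrable, that is
   [nu]-a.e., hence this weak form of [Lap (relax f) = relax (Lap f)]. *)
Lemma dotp_Lap_relax f g : L2 nu f -> L2 nu g ->
  dotp nu g (Lap m (relax f)) = dotp nu g (relax (Lap m f)).
Proof.
move=> Lf Lg; have LL := L2_Lap Lf; have LLL := L2_Lap LL.
rewrite green//; last exact: L2_relax.
by rewrite /relax dotp_linr// energy_linr// !green//; ring.
Qed.

Lemma le0_geometric (a K r : R) : 0 <= r -> r < 1 ->
  (forall k, a <= K * r ^+ k) -> a <= 0.
Proof.
move=> r0 r1 H; have c : (fun k => K * r ^+ k) @ \oo --> (0 : R).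
  by rewrite -(mulr0 K); apply: cvgMl_tmp; apply: cvg_expr; rewrite ger0_norm.
have <- := cvg_lim (@Rhausdorff R) c.
by apply: limr_ge; [apply/cvg_ex; exists 0|exact: nearW].
Qed.

Section relaxation.
Variables (lam : R) (h : T -> R).
Hypotheses (Herg : Lap_ergodic m nu) (lam0 : 0 < lam) (Hgap : gapped lam).
Hypotheses (Lh : L2 nu h) (h0 : \int[nu]_x h x = 0).

Let F k := iter k relax h.

Let FS k : F k.+1 = relax (F k). Proof. by []. Qed.

Let LF k : L2 nu (F k).
Proof. by elim: k => //= k IH; exact: L2_relax. Qed.

Let u k := Lap m (F k).

Let Lu k : L2 nu (u k). Proof. exact: L2_Lap. Qed.

(** [dotp_relax_le] and [gapped_Lap] give the factor [1 - lam / 2] for squared norms; the minimum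
    keeps it nonnegative when [lam] is large. *)
Let r : R := 1 - Num.min lam 1 / 2.

Let r_itv : 0 <= r /\ r < 1.
Proof.
have min0 : 0 < Num.min lam 1 by rewrite lt_min lam0 ltr01.
have min1 : Num.min lam 1 <= 1 by rewrite ge_min lexx orbT.
by rewrite /r; split; lra.
Qed.

Let u_contract k : dotp nu (u k.+1) (u k.+1) <= r * dotp nu (u k) (u k).
Proof.
have LQ := L2_relax (Lu k).
(* The weak commutation is tested first against [u k.+1], then against [relax (u k)]. *)
have -> : dotp nu (u k.+1) (u k.+1) = dotp nu (relax (u k)) (relax (u k)).
  rewrite [LHS](dotp_Lap_relax (LF k) (Lu k.+1)) dotpC.
  by rewrite [LHS](dotp_Lap_relax (LF k) LQ).
apply: le_trans (dotp_relax_le (Lu k)) _.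
have := gapped_Lap lam0 Hgap (LF k); rewrite -/(u k).
have := dotp_ge0 nu (u k); have := energy_ge0 (u k).
set N := dotp _ _ _; set E := energy _ _ => E0 N0 lN.
have : Num.min lam 1 * N <= lam * N by rewrite ler_wpM2r// ge_min lexx.
by rewrite /r; lra.
Qed.

Let U := dotp nu (u 0%N) (u 0%N).

Let u_le k : dotp nu (u k) (u k) <= U * r ^+ k.
Proof.
elim: k => [|k IH]; first by rewrite mulr1.
apply: le_trans (u_contract k) _; rewrite exprS mulrCA.
by rewrite ler_wpM2l//; case: r_itv.
Qed.

(** [r] governs squared norms, [q] norms. The increments of [F] are [u k / 2], whence the half in
    [C] below. *)
Let q := Num.sqrt r.
Let q2 : q ^+ 2 = r. Proof. by rewrite sqr_sqrtr//; case: r_itv. Qed.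
Let q0 : 0 <= q. Proof. exact: sqrtr_ge0. Qed.
Let q1 : q < 1.
Proof. by rewrite -sqrtr1 ltr_sqrt//; case: r_itv. Qed.

Let qk k : (q ^+ k) ^+ 2 = r ^+ k. Proof. by rewrite exprAC q2. Qed.

Let C := Num.sqrt U / 2.
Let C0 : 0 <= C. Proof. by rewrite divr_ge0. Qed.

Let step_le k :
  dotp nu (fun x => 1 * F k.+1 x + (-1) * F k x)
          (fun x => 1 * F k.+1 x + (-1) * F k x) <= (C * q ^+ k) ^+ 2.
Proof.
rewrite (_ : dotp _ _ _ = 4^-1 * dotp nu (u k) (u k)).
  have -> : (C * q ^+ k) ^+ 2 = U * r ^+ k / 4.
    by rewrite exprMn qk exprMn sqr_sqrtr ?dotp_ge0//; field.
  by have := u_le k; lra.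
rewrite /dotp -RintegralZl//; last exact: L2_mul_integrable.
by apply: eq_Rintegral => x _; rewrite /F /= /relax -/(F k) -/(u k); field.
Qed.

Let F_int k : dotp nu (cst 1) (F k) = 0.
Proof.
elim: k => [|k IH].
  by rewrite /dotp; under eq_Rintegral do rewrite mul1r.
rewrite FS dotp_relaxr//; last exact: L2_cst.
by rewrite IH energyC energy_cst; ring.
Qed.

Let decay : exists K, forall k, dotp nu (F k) (F k) <= (K * q ^+ k) ^+ 2.
Proof.
have [g Lg gF] := L2_complete LF C0 q0 q1 step_le.
pose B k := C * q ^+ k / (1 - q).
pose e k x := 1 * g x + (-1) * F k x.
have Le k : L2 nu (e k) by exact: L2_lin.
have ge k v : L2 nu v -> dotp nu v g = dotp nu v (e k) + dotp nu v (F k).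
  by move=> Lv; rewrite dotp_linr//; ring.
have L1 := L2_cst nu 1; have LLg := L2_Lap Lg.
have r0 := r_itv.1; have r1 := r_itv.2.
have Lg0 : dotp nu (Lap m g) (Lap m g) = 0.
  set N := dotp _ _ _; have LLLg := L2_Lap LLg.
  (* Green's formula moves [Lap] off [g]; then [g] splits as [e k + F k], and [Lap] returns to
     [F k]. Both resulting terms tend to zero. *)
  have NE k : N = dotp nu (Lap m (Lap m g)) (e k) + dotp nu (Lap m g) (u k).
    rewrite /N green// energyC -green// dotpC (ge k)//; congr (_ + _).
    by rewrite dotpC green// energyC -green.
  apply/eqP; rewrite -sqrf_eq0 eq_le sqr_ge0 andbT.
  pose N2 := dotp nu (Lap m (Lap m g)) (Lap m (Lap m g)).
  apply: (@le0_geometric _ (2 * (N2 * (C / (1 - q)) ^+ 2 + N * U)) r) => // k.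
  have CS1 := CauchySchwarz LLLg (Le k); have CS2 := CauchySchwarz LLg (Lu k).
  rewrite {1}(NE k).
  have b1 : N2 * dotp nu (e k) (e k) <= N2 * ((C / (1 - q)) ^+ 2 * r ^+ k).
    rewrite ler_wpM2l ?dotp_ge0//; apply: le_trans (gF k) _.
    by rewrite -qk -exprMn mulrAC.
  have b2 : N * dotp nu (u k) (u k) <= N * (U * r ^+ k).
    by rewrite ler_wpM2l ?dotp_ge0.
  move: CS1 CS2; rewrite -/N -/N2.
  set X := dotp _ _ (e k); set Y := dotp _ _ (u k) => CS1 CS2.
  by have := sqr_ge0 (X - Y); lra.
have [c gc] := Herg Lg (dotp_eq0 LLg Lg0).
(* [g] equals [c] only almost everywhere, so this is used through inner products. *)
have gv v : L2 nu v -> dotp nu v g = c * dotp nu v (cst 1).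
  move=> Lv; rewrite -RintegralZl//; last exact: L2_mul_integrable.
  have [mv _] := Lv; have [mg _] := Lg.
  congr fine; apply: ae_eq_integral => //.
  - by apply/measurable_EFinP; exact: measurable_funM.
  - by apply/measurable_EFinP; apply: measurable_funM => //; exact: measurable_funM.
  by apply: filterS gc => x -> _ /=; congr EFin; ring.
have one1 : dotp nu (cst 1) (cst 1) = 1.
  by rewrite /dotp /= Rintegral_prob_cst mulr1.
(* Relaxation preserves the zero mean, so [c] is the mean of [e k] for every [k]. *)
have c0 : c = 0.
  apply/eqP; rewrite -sqrf_eq0 eq_le sqr_ge0 andbT.
  apply: (@le0_geometric _ ((C / (1 - q)) ^+ 2) r) => // k.
  have := CauchySchwarz L1 (Le k); have := ge k _ L1.
  rewrite gv// one1 mulr1 F_int addr0 mul1r => <- /le_trans; apply.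
  by apply: le_trans (gF k) _; rewrite -qk -exprMn mulrAC.
exists (C / (1 - q)) => k.
have := gF k; rewrite -/(e k) [X in _ -> _ <= X ^+ 2]mulrAC; apply: le_trans.
(* As [g] vanishes almost everywhere, pairing it with [e k] and with [F k] shows that these have
   equal norms. *)
have := ge k _ (Le k); have := ge k _ (LF k).
by rewrite !gv// c0 !mul0r (dotpC _ (e k) (F k)); lra.
Qed.

Let G k x : R := \sum_(j < k) F j x.

Let G0 : G 0 = cst 0.
Proof. by apply/funext => x; rewrite /G big_ord0. Qed.

Let GS k : G k.+1 = (fun x => 1 * G k x + 1 * F k x).
Proof. by apply/funext => x; rewrite /G big_ord_recr/= !mul1r. Qed.

Let LG k : L2 nu (G k).
Proof.
by elim: k => [|k IH]; [rewrite G0; exact: L2_cst|rewrite GS; exact: L2_lin].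
Qed.

(** Weak form of [h - F k = - Lap (G k) / 2], each summand telescoping by [dotp_relaxr]. *)
Let telescope_G k v : L2 nu v ->
  dotp nu v h - dotp nu v (F k) = energy v (G k) / 2.
Proof.
move=> Lv; elim: k => [|k IH]; first by rewrite subrr G0 energy_cst mul0r.
by rewrite GS energy_linr// FS dotp_relaxr//; lra.
Qed.

Lemma gapped_energy : lam * dotp nu h h <= energy h h.
Proof.
have [K dec] := decay.
set H := dotp nu h h; set E := energy h h.
have H0 : 0 <= H := dotp_ge0 nu h; have E0 : 0 <= E := energy_ge0 h.
(* With [s = h - F k], this is [lam * <h, s>^2 <= E * |s|^2]: Cauchy-Schwarz for the energy of [h]
   and [G k], then [Hgap] at [G k]. *)
have key k : lam * (H - dotp nu h (F k)) ^+ 2 <=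
    E * (H - 2 * dotp nu h (F k) + dotp nu (F k) (F k)).
  pose s x := 1 * h x + (-1) * F k x.
  have Ls : L2 nu s by exact: L2_lin.
  have LLG := L2_Lap (LG k).
  have sv v : L2 nu v -> dotp nu v s = energy v (G k) / 2.
    by move=> Lv; rewrite /s dotp_linr// -telescope_G//; ring.
  have ss : dotp nu s s = dotp nu (Lap m (G k)) (Lap m (G k)) / 4.
    rewrite sv// -[energy s _]opprK -green// dotpC sv//.
    by rewrite -[energy _ (G k)]opprK -green//; field.
  have <- : dotp nu s s = H - 2 * dotp nu h (F k) + dotp nu (F k) (F k).
    by rewrite {1}/s dotp_linl// /s !dotp_linr// (dotpC _ (F k) h) -/H; ring.
  have <- : dotp nu h s = H - dotp nu h (F k).
    by rewrite /s dotp_linr// -/H; ring.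
  rewrite ss sv//; have := energy_CauchySchwarz Lh (LG k); rewrite -/E.
  have := Hgap (LG k); have := energy_ge0 (G k).
  set P := energy _ (G k); set Q := dotp _ _ _; set S := energy _ _.
  move=> P0 lP SEP.
  have : lam * S ^+ 2 <= lam * (E * P) by rewrite ler_pM2l.
  have : E * (lam * P) <= E * Q by rewrite ler_wpM2l.
  by lra.
have le0 : lam * H ^+ 2 - E * H <= 0.
  (* [M * q ^+ k] bounds [|<h, F k>|]; the sign of [K] is unknown, hence the root of its square. The
     constant below collects the error terms of the expanded [key], using [q ^+ k <= 1] to bound the
     squared rate by [q ^+ k]. *)
  pose M := Num.sqrt (H * K ^+ 2).
  apply: (@le0_geometric _ ((2 * lam * H + 2 * E) * M + E * K ^+ 2) q) => // k.
  set t := q ^+ k; have t0 : 0 <= t by rewrite exprn_ge0.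
  have t1 : t <= 1 by rewrite exprn_ile1// ltW.
  have := key k; have := dec k; have := CauchySchwarz Lh (LF k); rewrite -/H -/t.
  set x := dotp nu h _; set y := dotp nu _ _ => xy yK kk.
  have xM : `|x| <= M * t.
    have Mt0 : 0 <= M * t by rewrite mulr_ge0 ?sqrtr_ge0.
    rewrite -ler_sqr ?nnegrE// real_normK ?num_real//.
    rewrite exprMn sqr_sqrtr; last by apply: mulr_ge0 => //; exact: sqr_ge0.
    by apply: le_trans xy _; rewrite -mulrA -exprMn ler_wpM2l.
  have yt : E * y <= E * (K ^+ 2 * t).
    rewrite ler_wpM2l//; apply: le_trans yK _; rewrite exprMn ler_wpM2l ?sqr_ge0//.
    by rewrite expr2 ler_piMl.
  move: xM; rewrite ler_norml => /andP[xM1 xM2].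
  have b1 : lam * H * x <= lam * H * (M * t) by rewrite ler_wpM2l// mulr_ge0// ltW.
  have b2 : E * (- x) <= E * (M * t) by rewrite ler_wpM2l//; lra.
  have b3 : 0 <= lam * x ^+ 2 by rewrite mulr_ge0 ?sqr_ge0// ltW.
  by lra.
move: H0; rewrite le_eqVlt => /predU1P[<-|H0]; first by rewrite mulr0.
by rewrite -(ler_pM2r H0); lra.
Qed.

End relaxation.

End reversible_walk.

(** * The equivalence and the bounds on the spectral gap *)

Lemma gapped_poincare {R : realType} {d : measure_display} {T : measurableType d}
    (m : R.-pker T ~> T) (nu : probability T R) (lam : R) :
  nu_reversible m nu -> Lap_ergodic m nu -> 0 < lam ->
  gapped m nu lam -> poincare m nu lam.
Proof.
move=> Hrev Herg lam0 G; apply/(poincareP Hrev) => f Lf.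
have := gapped_energy Hrev Herg lam0 G (L2_center Lf) (Rintegral_center Lf).
by rewrite /energy grad_center.
Qed.

Theorem theorem3p18 (R : realType) (d : measure_display) (T : measurableType d)
  (dist : T -> T -> R) (m : R.-pker T ~> T) (nu : probability T R)
  (Hmrw : metric_random_walk dist m)
  (Hinv : nu_invariant m nu) (Hrev : nu_reversible m nu) (Herg : Lap_ergodic m nu) :
  (forall K n : R, 0 < K -> 1 < n ->
     (IBE m nu K n <-> poincare m nu (K * (n / (n - 1))))) /\
  (forall K : R, 0 < K -> (IBE_inf m nu K <-> poincare m nu K)) /\
  (forall K n : R, 0 < K -> 1 < n ->
     BE m nu K n -> ((K * (n / (n - 1)))%:E <= gap m nu)%E) /\
  (forall K : R, 0 < K -> BE_inf m nu K -> (K%:E <= gap m nu)%E).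
Proof.
have main lam : 0 < lam -> gapped m nu lam <-> poincare m nu lam.
  move=> lam0; split; first exact: gapped_poincare.
  exact: poincare_gapped.
have lam_gt0 (K n : R) : 0 < K -> 1 < n -> 0 < K * (n / (n - 1)).
  by move=> K0 n1; rewrite mulr_gt0// divr_gt0// ?subr_gt0// (lt_trans ltr01).
split; [|split; [|split]].
- move=> K n K0 n1; rewrite -main; last exact: lam_gt0.
  by apply: iff_sym; exact: gappedP.
- by move=> K K0; rewrite -main//; apply: iff_sym; exact: gappedP.
- move=> K n K0 n1 be; apply: poincare_le_gap => //.
  apply/main; first exact: lam_gt0.
  move=> f Lf; have := integrated_BE Hrev Lf (be f Lf).
  have n0 : 0 < n by exact: lt_trans n1.
  have n10 : 0 < n - 1 by rewrite subr_gt0.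
  set N := dotp _ _ _ => KE.
  (* [n / (n - 1)] is the inverse of the factor [1 - n^-1] left by [integrated_BE]. *)
  rewrite (_ : N = (1 - n^-1) * N * (n / (n - 1))).
    by rewrite mulrAC ler_wpM2r// divr_ge0// ltW.
  by field; rewrite !gt_eqF.
- move=> K K0 be; apply: poincare_le_gap => //; apply/main => // f Lf.
  have := @integrated_BE _ _ _ _ _ Hrev 0 K f Lf; rewrite subr0 mul1r; apply.
  by apply: filterS (be f Lf) => x; rewrite mulr0 add0r.
Qed.
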